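(* Let $\overline{E}$ be a nonempty finite family of nonempty convex polytopes in $\mathbb{R}^{n+1}$, and let $h\colon\mathbb{R}^n\to\mathbb{R}$ be the piecewise affine function $$h(x)=\min_{C\in\overline{E}}\ \max_{[a,v]\in C}\,[a+\langle v,x\rangle].$$ Let $L_0=\{(a,0_n)\in\mathbb{R}^{n+1} : a\in\mathbb{R}\}$. If there exists $C\in\overline{E}$ such that $C\cap L_0=\emptyset$, then $h$ is not bounded from below on $\mathbb{R}^n$. Otherwise (that is, if $C\cap L_0\neq\emptyset$ for all $C\in\overline{E}$), $$\min_{x\in\mathbb{R}^n}h(x)=a_\ast,\qquad\text{where } a_\ast=\min_{C\in\overline{E}}\ \max_{[a,0_n]\in C}a,$$ i.e. $a_\ast$ is the minimum value of $h$ on $\mathbb{R}^n$.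
   Context: Points of $\mathbb{R}^{n+1}$ are written $[a,v]$ or $(a,v)$ with $a\in\mathbb{R}$, $v\in\mathbb{R}^n$; $0_n$ is the zero vector of $\mathbb{R}^n$ and $\langle\cdot,\cdot\rangle$ is the standard inner product. A convex polytope is the convex hull of a finite set of points. The notation $\max_{[a,0_n]\in C}a$ means the maximum of $a$ over all $a\in\mathbb{R}$ such that $[a,0_n]\in C$. *)

(* Defs.v *)
From HB Require Import structures.
From mathcomp Require Import all_boot all_order all_algebra.
From mathcomp Require Import mathcomp_extra boolp classical_sets cardinality.
From mathcomp Require Import reals convex.

Set Implicit Arguments.
Unset Strict Implicit.
Unset Printing Implicit Defensive.

Import Order.TTheory GRing.Theory Num.Theory.

Local Open Scope classical_set_scope.
Local Open Scope ring_scope.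

Section Extrema.
Variable R : realType.
Implicit Types (A : set R) (m : R).

Definition is_max A m := A m /\ ubound A m.
Definition is_min A m := A m /\ lbound A m.

(* A genuine (attained) extremum; junk value 0 when there is none. *)
Definition setmax A : R := xget 0 (is_max A).
Definition setmin A : R := xget 0 (is_min A).

End Extrema.

Section Polytopes.
Variable R : realType.

Definition convex_hull (M : lmodType R) (X : set M) : set M :=
  smallest (@convex_set R M) X.

Definition polytope (M : lmodType R) (C : set M) : Prop :=
  exists2 X : set M, finite_set X & C = convex_hull X.

End Polytopes.

Section MinMax.
(* Under the intended hypotheses (E finite and nonempty, its members nonempty
   polytopes, meeting the axis where max_on_axis is concerned) every set passed
   to setmax or setmin below has an extremum, so junk values do not occur. *)
Variables (R : realType) (n : nat).
Implicit Types (a : R) (v x : 'rV[R]_n) (C : set 'rV[R]_(1 + n)).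
Implicit Type E : set (set 'rV[R]_(1 + n)).

(* The point [a, v] of R^(n+1): first coordinate a, remaining ones v. *)
Definition pt a v : 'rV[R]_(1 + n) := row_mx a%:M v.

Definition dotv v x : R := \sum_(i < n) v 0 i * x 0 i.

Definition max_affine C x : R :=
  setmax [set y | exists a v, C (pt a v) /\ y = a + dotv v x].

Definition min_max_affine E x : R := setmin [set max_affine C x | C in E].

Definition vertical_axis : set 'rV[R]_(1 + n) := [set pt a 0 | a in setT].

Definition max_on_axis C : R := setmax [set a | C (pt a 0)].

Definition min_max_on_axis E : R := setmin [set max_on_axis C | C in E].

End MinMax.

Arguments vertical_axis {R n}.

(* Main.v *)
Require Import Defs.
From mathcomp Require Import all_boot all_order all_algebra.
From mathcomp Require Import boolp classical_sets cardinality reals.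
From mathcomp Require Import interval_inference convex.

Import Order.TTheory GRing.Theory Num.Theory.
Local Open Scope classical_set_scope.
Local Open Scope ring_scope.

(** The two halves are both instances of linear programming duality, which is
    derived here from Farkas' lemma. Write a polytope C as the hull of finitely
    many points [a_i, v_i], so that the inner maximum at x is the largest
    a_i + <v_i, x>.

    If C misses the vertical axis, then 0 is not in the projection of C to the
    last n coordinates, and [polytope_separation] gives a direction x with
    <v, x> <= -1 for every [a, v] in C. Along that ray the inner maximum of C,
    hence h, tends to minus infinity ([max_affine_unbounded]).

    If C meets the axis at [a, 0], then a = a + <0, x> is at most the inner
    maximum of C at every x, so h >= a_star everywhere. That the bound is
    reached is [max_affine_attained]: let s be the largest a with [a, 0] in C.
    If no x satisfied a_i + <v_i, x> <= s for all i, then Gale's alternative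
    would supply weights l_i >= 0 with sum_i l_i v_i = 0 and
    sum_i l_i (a_i - s) = 1, and after normalisation these weights produce a
    point of C on the axis strictly above [s, 0].
    Applying this to a member C of the family whose s is least gives an x with
    h x <= a_star.

    The maximum on the axis exists because a polytope that does not contain
    [s, 0] can be separated from it by a positive gap ([polytope_separation]
    again), so the supremum s of the axis section belongs to that section. *)

(** * Theorems of the alternative *)

(** Induction on the number m of inequalities, over an arbitrary real field and
    without topology. Either the first inequality a x <= 0 is redundant, or some
    z satisfies the others with g z > 0, hence a z > 0; rescaling to z1 with
    a z1 = 1, the map x |-> x - (a x) z1 projects onto the hyperplane a x = 0,
    where only the other inequalities remain. The multiplier of a
    is g z1 - l B z1, nonnegative because g z1 >= 0 and B z1 <= 0. *)
Lemma farkas {F : realFieldType} {m N : nat} (A : 'M[F]_(m, N)) (g : 'rV[F]_N) :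
  (forall x : 'cV[F]_N, (forall i, (A *m x) i 0 <= 0) -> (g *m x) 0 0 <= 0) ->
  exists2 l : 'rV[F]_m, forall i, 0 <= l 0 i & g = l *m A.
Proof.
elim: m A g => [|m IHm]; last rewrite -[m.+1]/(1 + m)%N; move=> A g gA.
  exists 0 => [i|]; first by rewrite mxE.
  rewrite mul0mx; apply/rowP => j; rewrite mxE.
  have ge_le0 e : e * g 0 j <= 0.
    have ge := gA (e *: delta_mx j 0) ltac:(by case).
    by move: ge; rewrite -scalemxAr -colE !mxE.
  apply/eqP; rewrite eq_le -[X in X <= _]mul1r ge_le0 /=.
  by rewrite -oppr_le0 -mulN1r ge_le0.
pose a : 'rV_N := usubmx A.
pose B := dsubmx A.
have A_blocks : A = col_mx a B by rewrite vsubmxK.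
have A_le0 x : (a *m x) 0 0 <= 0 -> (forall i, (B *m x) i 0 <= 0) ->
    forall i, (A *m x) i 0 <= 0.
  move=> ax Bx i; rewrite A_blocks mul_col_mx.
  by case: (split_ordP i) => j ->; rewrite ?col_mxEu ?col_mxEd // ord1.
have [gB|] := pselect (forall x : 'cV_N,
    (forall i, (B *m x) i 0 <= 0) -> (g *m x) 0 0 <= 0).
  have [l l_ge0 ->] := IHm B g gB.
  exists (row_mx 0 l) => [i|].
    case: (split_ordP i) => j ->; rewrite ?row_mxEl ?row_mxEr ?mxE //.
  by rewrite A_blocks mul_row_col mul0mx add0r.
move=> /existsNP[z /not_implyP[Bz /negP]]; rewrite -ltNge => gz_gt0.
have az_gt0 : 0 < (a *m z) 0 0.
  rewrite ltNge; apply/negP => az; move: gz_gt0.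
  by rewrite ltNge gA //; exact: A_le0.
pose z1 := ((a *m z) 0 0)^-1 *: z.
have az1 : a *m z1 = 1%:M.
  by rewrite -scalemxAr {2}[a *m z]mx11_scalar scale_scalar_mx mulVf ?gt_eqF.
have Bz1 i : (B *m z1) i 0 <= 0.
  by rewrite -scalemxAr mxE mulr_ge0_le0 // invr_ge0 ltW.
have gz1 : 0 <= (g *m z1) 0 0.
  by rewrite -scalemxAr mxE mulr_ge0 ?invr_ge0 // ltW.
(* The induction hypothesis applies to B and g composed with the projection. *)
have [x Bx|l l_ge0 gE] := IHm (B - B *m z1 *m a) (g - g *m z1 *m a).
  have projE k (M : 'M_(k, N)) :
      (M - M *m z1 *m a) *m x = M *m (x - z1 *m (a *m x)).
    by rewrite mulmxBl mulmxBr !mulmxA.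
  rewrite projE; apply: gA; apply: A_le0 => [|i]; last by rewrite -projE.
  by rewrite mulmxBr mulmxA az1 mul1mx subrr mxE.
pose l0 := g *m z1 - l *m (B *m z1).
exists (row_mx l0 l) => [i|]; last first.
  rewrite A_blocks mul_row_col /l0 mulmxBl -[LHS](subrK (g *m z1 *m a)) gE.
  by rewrite mulmxBr !mulmxA addrC -addrA [- _ + _]addrC.
case: (split_ordP i) => j ->; rewrite ?row_mxEl ?row_mxEr //.
rewrite ord1 mxE [X in _ + X]mxE subr_ge0; apply: le_trans gz1.
by rewrite mxE sumr_le0 // => k _; rewrite mulr_ge0_le0.
Qed.

(** The affine system b + A x <= 0 is homogenised: it is solvable iff the linear
    system t b + A x <= 0 has a solution with t > 0, that is, iff t <= 0 is not
    among its consequences. *)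
Lemma gale_alternative {F : realFieldType} {m N : nat}
    (A : 'M[F]_(m, N)) (b : 'cV[F]_m) :
  (exists x : 'cV[F]_N, forall i, b i 0 + (A *m x) i 0 <= 0) \/
  (exists l : 'rV[F]_m,
    [/\ forall i, 0 <= l 0 i, l *m b = 1%:M & l *m A = 0]).
Proof.
have [|noy] := pselect (exists2 y : 'cV_(1 + N),
    forall i, (row_mx b A *m y) i 0 <= 0 & 0 < usubmx y 0 0).
  case=> y; rewrite -[y]vsubmxK col_mxKu mul_row_col; set t := usubmx y.
  set x := dsubmx y => Ay t_gt0; left; exists ((t 0 0)^-1 *: x) => i.
  rewrite -(pmulr_rle0 _ t_gt0) mulrDr -scalemxAr [(_ *: (A *m x)) _ _]mxE.
  rewrite mulVKf ?gt_eqF //.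
  by have := Ay i; rewrite mxE [t]mx11_scalar mul_mx_scalar !mxE eqxx mulr1n.
right; have [y Ay|l l_ge0] := farkas (row_mx b A) (row_mx 1%:M 0).
  rewrite -[y]vsubmxK mul_row_col mul1mx mul0mx addr0 leNgt.
  by apply/negP => y_gt0; apply: noy; exists y.
by rewrite mul_mx_row => /eq_row_mx[lb lA]; exists l.
Qed.

(** * Convex hulls and polytopes *)

Section Hull.
Context {R : realType}.

Lemma convex_setP {V : lmodType R} (X : set V) :
  convex_set X <->
  (forall p q k,
    X p -> X q -> 0 <= k -> k <= 1 -> X (k *: p + (1 - k) *: q)).
Proof.
split=> [cX p q k Xp Xq k0 k1|cX p q k]; last first.
  by rewrite !inE => Xp Xq; exact: cX.
by have := cX p q (Itv01 k0 k1); rewrite !inE; exact.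
Qed.

Lemma convex_halfspace {N : nat} (y : 'cV[R]_N) (c : R) :
  convex_set [set p : 'rV[R]_N | (p *m y) 0 0 <= c].
Proof.
apply/convex_setP => p q k /= py qy k_ge0 k_le1.
rewrite mulmxDl -!scalemxAl mxE [X in X + _]mxE [X in _ + X]mxE.
have -> : c = k * c + (1 - k) * c by rewrite mulrBl mul1r subrKC.
by rewrite lerD // ler_wpM2l // subr_ge0.
Qed.

(** The factor \sum_i w_i on the right, in place of a division on the left,
    makes the conical form valid also for zero total weight. *)
Lemma convex_set_sum {V : lmodType R} {I : Type} (X : set V)
    (s : seq I) (w : I -> R) (x : I -> V) :
  convex_set X -> X !=set0 -> (forall i, 0 <= w i) -> (forall i, X (x i)) ->
  exists2 p, X p & \sum_(i <- s) w i *: x i = (\sum_(i <- s) w i) *: p.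
Proof.
move=> /convex_setP cX [p0 Xp0] w_ge0 Xx; elim: s => [|i s [p Xp IHs]].
  by exists p0 => //; rewrite !big_nil scale0r.
rewrite !big_cons IHs; set W := \sum_(j <- s) w j.
have W_ge0 : 0 <= W by exact: sumr_ge0.
have [wW0|wW_neq0] := eqVneq (w i + W) 0.
  move/eqP: (wW0); rewrite paddr_eq0 // => /andP[/eqP -> /eqP ->].
  by exists p => //; rewrite addr0 !scale0r addr0.
have wW_gt0 : 0 < w i + W by rewrite lt0r wW_neq0 addr_ge0.
exists (w i / (w i + W) *: x i + (1 - w i / (w i + W)) *: p).
  by apply: cX; rewrite ?divr_ge0 ?ler_pdivrMr ?mul1r ?lerDl // ltW.
have wWE : (w i + W) * (w i / (w i + W)) = w i by rewrite mulrC divfK.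
by rewrite scalerDr !scalerA mulrBr mulr1 wWE [w i + W]addrC addrK.
Qed.

Lemma polytope_rows {N : nat} (C : set 'rV[R]_N) : polytope C ->
  exists m (P : 'M[R]_(m, N)), C = convex_hull (range (fun i => row i P)).
Proof.
case=> X /finite_seqP[s ->] ->.
exists (size s), (\matrix_(i < size s) s`_i); congr convex_hull.
apply/seteqP; split=> [p /= ps|_ [i _ <-]] /=.
  have ips : (index p s < size s)%N by rewrite index_mem.
  by exists (Ordinal ips) => //; rewrite rowK nth_index.
by rewrite rowK mem_nth.
Qed.

Lemma convex_convex_hull {V : lmodType R} (X : set V) :
  convex_set (convex_hull X).
Proof.
apply/convex_setP => p q k Xp Xq k0 k1 Y [cY XY].
by move/convex_setP: (cY); apply => //; [apply: Xp|apply: Xq].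
Qed.

Lemma convex_hull_le {N : nat} (X : set 'rV[R]_N) (y : 'cV_N) c :
  (forall p, X p -> (p *m y) 0 0 <= c) ->
  forall p, convex_hull X p -> (p *m y) 0 0 <= c.
Proof.
by move=> Xy; apply: smallest_sub; [exact: convex_halfspace|exact: Xy].
Qed.

Lemma convex_hull_mulmx {m N : nat} (P : 'M[R]_(m, N)) (l : 'rV_m) :
  let C := convex_hull (range (fun i => row i P)) in
  C !=set0 -> (forall i, 0 <= l 0 i) ->
  exists2 p, C p & l *m P = (\sum_i l 0 i) *: p.
Proof.
move=> C C0 l_ge0; rewrite mulmx_sum_row; apply: convex_set_sum => //.
  exact: convex_convex_hull.
by move=> i; apply: sub_gen_smallest; exists i.
Qed.

Lemma convex_hull_set0 {V : lmodType R} : convex_hull (set0 : set V) = set0.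
Proof.
by apply/seteqP; split=> // p; apply; split=> //; exact/convex_setP.
Qed.

(** Gale's alternative for the points p_i M - q, with constant term 1: its
    multipliers would sum to 1, and average the generators p_i to a point of C
    that M sends to q. The gap, rather than a mere strict inequality, makes the
    separation survive passage to a supremum. The matrix M allows separation
    both in the whole space and after a projection. *)
Lemma polytope_separation {N k : nat} (C : set 'rV[R]_N) (M : 'M_(N, k)) q :
  polytope C -> C !=set0 -> ~ (exists2 p, C p & p *m M = q) ->
  exists y : 'cV_k, forall p, C p -> (p *m M *m y) 0 0 + 1 <= (q *m y) 0 0.
Proof.
move=> /polytope_rows[m [P ->]] C0 nCq; pose e : 'cV[R]_m := const_mx 1.
have [[y Py]|[l [l_ge0 le lPM]]] := gale_alternative (P *m M - e *m q) e.
  exists y => p Cp; rewrite -lerBrDr -mulmxA; move: p Cp.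
  apply: convex_hull_le => _ [i _ <-].
  rewrite -row_mul mxE lerBrDr addrC -subr_le0 -addrA.
  have -> : (q *m y) 0 0 = (e *m q *m y) i 0.
    by rewrite -mulmxA [q *m y]mx11_scalar mul_mx_scalar !mxE eqxx mulr1.
  by have := Py i; rewrite mulmxBl -[P *m M *m y]mulmxA !mxE.
have [p Cp lP] := convex_hull_mulmx P l C0 l_ge0.
have l1 : \sum_i l 0 i = 1.
  transitivity ((l *m e) 0 0); last by rewrite le mxE eqxx.
  by rewrite mxE; apply: eq_bigr => i _; rewrite mxE mulr1.
case: nCq; exists p => //; apply/eqP; rewrite -subr_eq0 -lPM mulmxBr !mulmxA.
by rewrite lP l1 le scale1r mul1mx.
Qed.

End Hull.

(** * Extrema of sets of reals *)

Section ExtremaTheory.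
Context {R : realType}.

Lemma setmaxP (A : set R) m : is_max A m -> is_max A (setmax A).
Proof. by move=> Am; apply: (xgetPex 0); exists m. Qed.

Lemma setminP (A : set R) m : is_min A m -> is_min A (setmin A).
Proof. by move=> Am; apply: (xgetPex 0); exists m. Qed.

Lemma finite_is_max (A : set R) :
  finite_set A -> A !=set0 -> exists m, is_max A m.
Proof.
move=> /finite_seqP[s ->] [i si]; pose i0 := SeqSub si.
have [m _ m_max] := @arg_maxP _ _ _ i0 xpredT val isT.
by exists (val m); split=> [|j js]; [exact: valP m|exact: (m_max (SeqSub js))].
Qed.

Lemma finite_is_min (A : set R) :
  finite_set A -> A !=set0 -> exists m, is_min A m.
Proof.
move=> /finite_seqP[s ->] [i si]; pose i0 := SeqSub si.
have [m _ m_min] := @arg_minP _ _ _ i0 xpredT val isT.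
by exists (val m); split=> [|j js]; [exact: valP m|exact: (m_min (SeqSub js))].
Qed.

Lemma setmin_imageP {T : Type} (E : set T) (f : T -> R) :
  finite_set E -> E !=set0 ->
  is_min [set f i | i in E] (setmin [set f i | i in E]).
Proof.
move=> finE [i Ei]; have [||m mP] := finite_is_min [set f i | i in E].
- exact: finite_image.
- by exists (f i), i.
exact: setminP mP.
Qed.

End ExtremaTheory.

(** * One polytope: inner maximum and section by the axis *)

Section OnePolytope.
Context {R : realType} {n : nat}.
Implicit Types (C : set 'rV[R]_(1 + n)) (v x : 'rV[R]_n) (a t : R).

Lemma pt_mul a t v x :
  (pt a v *m col_mx t%:M x^T) 0 0 = a * t + dotv v x.
Proof.
rewrite mul_row_col mxE -scalar_mxM mxE eqxx mulr1n; congr (_ + _).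
by rewrite mxE; apply: eq_bigr => i _; rewrite mxE.
Qed.

Lemma pt_eta (p : 'rV[R]_(1 + n)) : p = pt (lsubmx p 0 0) (rsubmx p).
Proof. by rewrite /pt -mx11_scalar hsubmxK. Qed.

Lemma col_eta (y : 'cV[R]_(1 + n)) :
  y = col_mx (usubmx y 0 0)%:M (dsubmx y)^T^T.
Proof. by rewrite -mx11_scalar trmxK vsubmxK. Qed.

(** A linear functional is maximised over a hull at one of the generators. *)
Lemma max_affineP C x : polytope C -> C !=set0 ->
  is_max [set y | exists a v, C (pt a v) /\ y = a + dotv v x] (max_affine C x).
Proof.
move=> [X finX ->] [p0 Cp0]; pose val p := (p *m col_mx 1%:M x^T : 'M[R]_1) 0 0.
have [||_ [[p Xp <-] Xmax]] := finite_is_max [set val p | p in X].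
- exact: finite_image.
- apply/set0P/negP => /eqP/image_set0_set0 X0.
  by move: Cp0; rewrite X0 convex_hull_set0.
apply: (setmaxP _ (val p)); split=> [|_ [a [v [Cav ->]]]].
  exists (lsubmx p 0 0), (rsubmx p); rewrite -pt_eta; split.
    exact: sub_gen_smallest.
  by rewrite -[X in X + _]mulr1 -pt_mul -pt_eta.
rewrite -[a]mulr1 -pt_mul; apply: convex_hull_le Cav => r Xr.
by apply: Xmax; exists r.
Qed.

Lemma max_affine_ge C x a v : polytope C -> C (pt a v) ->
  a + dotv v x <= max_affine C x.
Proof.
move=> polyC Cav.
have [|_ ub] := max_affineP C x polyC; first by exists (pt a v).
by apply: ub; exists a, v.
Qed.

Lemma max_affine_le C x c : polytope C -> C !=set0 ->
  (forall a v, C (pt a v) -> a + dotv v x <= c) -> max_affine C x <= c.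
Proof.
by move=> polyC /(max_affineP C x polyC)[[a [v [Cav ->]]] _]; apply.
Qed.

Lemma axis_neq0 C : C `&` vertical_axis !=set0 -> exists a, C (pt a 0).
Proof. by move=> [p [Cp [a _ ap]]]; exists a; rewrite ap. Qed.

Lemma dot0v x : dotv 0 x = 0.
Proof. by apply: big1 => i _; rewrite mxE mul0r. Qed.

Lemma dotv0 v : dotv v 0 = 0.
Proof. by apply: big1 => i _; rewrite mxE mulr0. Qed.

Lemma dotvZ v t x : dotv v (t *: x) = t * dotv v x.
Proof.
by rewrite /dotv mulr_sumr; apply: eq_bigr => i _; rewrite mxE mulrCA.
Qed.

Lemma dotvE v x : dotv v x = (v *m x^T) 0 0.
Proof. by rewrite /dotv [RHS]mxE; apply: eq_bigr => i _; rewrite mxE. Qed.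

(** If the supremum s of the section were missed, separating [s, 0] from C would
    give t > 0 with a t + 1 <= s t for all [a, 0] in C, making s - 1/t a smaller
    upper bound. *)
Lemma max_on_axisP C : polytope C -> (exists a, C (pt a 0)) ->
  is_max [set a | C (pt a 0)] (max_on_axis C).
Proof.
move=> polyC [a0 Ca0]; set A := [set a | C (pt a 0)].
have supA : has_sup A.
  split; first by exists a0.
  exists (max_affine C 0) => a Ca.
  by rewrite -[a]addr0 -(dot0v 0) max_affine_ge.
apply: (setmaxP _ (sup A)); split; last exact: sup_upper_bound.
apply: contrapT => nCs.
have [||y sep] := polytope_separation C 1%:M (pt (sup A) 0) polyC.
- by exists (pt a0 0).
- by case=> p Cp; rewrite mulmx1 => ps; apply: nCs; rewrite /A /= -ps.
pose t := usubmx y 0 0.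
have sepA a : A a -> a * t + 1 <= sup A * t.
  move=> /sep; rewrite mulmx1 (col_eta y) !pt_mul !dot0v !addr0; exact.
have t_gt0 : 0 < t.
  have a0s : a0 <= sup A by exact: sup_upper_bound.
  rewrite ltNge; apply/negP => t_le0; have := sepA _ Ca0.
  by rewrite leNgt (le_lt_trans (ler_wnM2r t_le0 a0s)) // ltrDl ltr01.
have : sup A <= sup A - t^-1.
  apply: sup_le_ub => [|a /sepA Aa]; first by exists a0.
  by rewrite lerBrDr -(ler_pM2r t_gt0) mulrDl mulVf ?gt_eqF.
by rewrite leNgt gtrBl invr_gt0 t_gt0.
Qed.

(** The tight half of the duality: multipliers that certify that the
    inequalities a_i + <v_i, x> <= s have no solution combine into a point of C
    on the axis above the maximum s. *)
Lemma max_affine_attained C : polytope C -> (exists a, C (pt a 0)) ->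
  exists x, max_affine C x <= max_on_axis C.
Proof.
move=> polyC C0; have [_ sub] := max_on_axisP C polyC C0.
have nC0 : C !=set0 by have [a Ca] := C0; exists (pt a 0).
set s := max_on_axis C in sub *.
have /polytope_rows[m [P CE]] := polyC.
have [[y Py]|[l [l_ge0 ls lV]]] :=
    gale_alternative (rsubmx P) (lsubmx P - const_mx s).
  exists y^T; apply: max_affine_le => // a v.
  rewrite CE => /convex_hull_le => le.
  rewrite -[a]mulr1 -pt_mul; apply: le => _ [i _ <-].
  rewrite trmxK -row_mul mxE -[P]hsubmxK mul_row_col mulmx1 -subr_le0.
  by have := Py i; rewrite !mxE addrAC.
move: (nC0); rewrite CE => nH.
have [p Cp lP] := convex_hull_mulmx P l nH l_ge0.
set L := \sum_i l 0 i in lP.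
have /eq_row_mx[la lv] : row_mx (l *m lsubmx P) (l *m rsubmx P) =
    row_mx (L *: lsubmx p) (L *: rsubmx p).
  by rewrite -mul_mx_row -scale_row_mx !hsubmxK.
have pL : L * (lsubmx p 0 0 - s) = 1.
  transitivity ((l *m (lsubmx P - const_mx s)) 0 0);
    last by rewrite ls mxE eqxx.
  rewrite mulmxBr la mulrBr !mxE; congr (_ - _); rewrite mulr_suml.
  by apply: eq_bigr => i _; rewrite mxE.
have L_neq0 : L != 0.
  by apply/eqP => L0; move/eqP: pL; rewrite L0 mul0r eq_sym oner_eq0.
have L_gt0 : 0 < L by rewrite lt0r L_neq0 sumr_ge0.
(* The last n coordinates of p vanish, so p lies on the axis. *)
have p0 : p = pt (lsubmx p 0 0) 0.
  have /eqP : L *: rsubmx p = 0 by rewrite -lv.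
  rewrite scaler_eq0 (negPf L_neq0) => /eqP <-; exact: pt_eta.
have := sub (lsubmx p 0 0); rewrite /= -p0 CE => /(_ Cp).
by rewrite leNgt -subr_gt0 -(pmulr_rgt0 _ L_gt0) pL ltr01.
Qed.

Lemma max_affine_unbounded C :
  polytope C -> C !=set0 -> C `&` vertical_axis = set0 ->
  forall c, exists x, max_affine C x < c.
Proof.
move=> polyC C0 Caxis c.
pose M : 'M[R]_(1 + n, n) := col_mx 0 1%:M.
have [|y sep] := polytope_separation C M 0 polyC C0.
  case=> p Cp; rewrite [p]pt_eta mul_row_col mulmx0 mulmx1 add0r => p0.
  suff : (C `&` vertical_axis) p by rewrite Caxis.
  by split=> //; exists (lsubmx p 0 0) => //; rewrite [RHS]pt_eta p0.
have {}sep a v : C (pt a v) -> dotv v y^T <= -1.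
  move=> /sep; rewrite mul_row_col mulmx0 mulmx1 add0r mul0mx [X in _ <= X]mxE.
  by rewrite -{1}[y]trmxK -dotvE -lerBrDr sub0r.
(* At t y^T the inner maximum is at most b - t, as <v, y^T> <= -1 on C. *)
pose b := max_affine C 0; pose t := `|b - c| + 1.
exists (t *: y^T); apply: (@le_lt_trans _ _ (b - t)); last first.
  by rewrite ltrBlDr -ltrBlDl (le_lt_trans (ler_norm _)) // ltrDl ltr01.
apply: max_affine_le => // a v Cav; rewrite dotvZ lerD //.
  by rewrite -[a]addr0 -(dotv0 v) max_affine_ge.
rewrite -mulrN1 ler_wpM2l ?sep //; last exact: sep Cav.
by rewrite /t addr_ge0.
Qed.

End OnePolytope.

(** * The min-max function of a family *)

Theorem theorem3 (R : realType) (n : nat) (E : set (set 'rV[R]_(1 + n)))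
    (finE : finite_set E) (neE : E !=set0)
    (polyE : forall C, E C -> polytope C /\ C !=set0) :
  let h : 'rV[R]_n -> R := min_max_affine E in
  let L0 : set 'rV[R]_(1 + n) := vertical_axis in
  let astar : R := min_max_on_axis E in
  ((exists C, E C /\ C `&` L0 = set0) -> ~ has_lbound (range h)) /\
  ((forall C, E C -> C `&` L0 !=set0) -> is_min (range h) astar).
Proof.
move=> h L0 astar.
have hP x : is_min [set max_affine C x | C in E] (h x) by exact: setmin_imageP.
split=> [[C [EC CL0]] [c lb_c]|axisE].
  have [polyC C0] := polyE C EC.
  have [x Cx] := max_affine_unbounded C polyC C0 CL0 c.
  have := lb_c (h x) (ex_intro2 _ _ x I erefl); apply/negP; rewrite -ltNge.
  by apply: le_lt_trans Cx; apply: (hP x).2; exists C.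
have [[C EC Castar] astar_min] := setmin_imageP E (@max_on_axis R n) finE neE.
have h_ge x : astar <= h x.
  have [[D ED hx] _] := hP x; rewrite -[h x]hx.
  have [polyD _] := polyE D ED; have D0 := axis_neq0 D (axisE D ED).
  apply: (@le_trans _ _ (max_on_axis D)); first by apply: astar_min; exists D.
  have [Dmax _] := max_on_axisP D polyD D0.
  by rewrite -[max_on_axis D]addr0 -(dot0v x) max_affine_ge.
split=> [|_ [x _ <-]]; last exact: h_ge.
have [polyC _] := polyE C EC; have C0 := axis_neq0 C (axisE C EC).
have [x Cx] := max_affine_attained C polyC C0.
exists x => //; apply/eqP; rewrite eq_le h_ge andbT.
rewrite -[astar]Castar.
by apply: le_trans Cx; apply: (hP x).2; exists C.
Qed.
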